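(* Let $T\in\mathcal{S}'(\mathbb{R})$ and $\varphi\in\mathcal{S}(\mathbb{R})$. If all weak moments ${}^{(\varphi)}m_n=\langle T,x^n\varphi\rangle$ exist and ${}^{(\varphi)}\phi(0)\ne0$, then all weak cumulants ${}^{(\varphi)}\kappa_n$, $n\ge1$, exist.
   Context: $\mathcal{S}(\mathbb{R})$, $\mathcal{S}'(\mathbb{R})$ denote Schwartz functions and tempered distributions. The weak characteristic function of the pair $(T,\varphi)$ is ${}^{(\varphi)}\phi(t):=\langle T,e^{itx}\varphi(x)\rangle$. The weak cumulant generating function, defined on a neighbourhood of $0$ where ${}^{(\varphi)}\phi\neq0$, is ${}^{(\varphi)}K(t):=\log{}^{(\varphi)}\phi(t)$ (continuous branch), and the $n$-th weak cumulant is ${}^{(\varphi)}\kappa_n:=i^{-n}\frac{d^n}{dt^n}{}^{(\varphi)}K(t)\big|_{t=0}$; it exists if ${}^{(\varphi)}K$ is defined near $0$ and $n$ times differentiable at $0$. *)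

(* Defs.v *)
From Stdlib Require Import Reals Lra Lia.
From Coquelicot Require Import Coquelicot.

Open Scope R_scope.

Definition Cderive_n (f : R -> C) (n : nat) (x : R) : C :=
  (Derive_n (fun y => Re (f y)) n x, Derive_n (fun y => Im (f y)) n x).

Definition ex_Cderive_n (f : R -> C) (n : nat) (x : R) : Prop :=
  ex_derive_n (fun y => Re (f y)) n x /\ ex_derive_n (fun y => Im (f y)) n x.

(** [ex_derive_n f n x] alone only says that the total function
    [Derive_n f (n - 1)] is differentiable at [x]; the lower derivatives have
    to be required to exist on a neighbourhood of [x]. *)
Definition Cdifferentiable_n (f : R -> C) (n : nat) (x : R) : Prop :=
  locally x (fun y => forall k, (k < n)%nat -> ex_Cderive_n f k y) /\
  ex_Cderive_n f n x.

Definition Cexp (z : C) : C :=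
  (exp (Re z) * cos (Im z), exp (Re z) * sin (Im z)).

Definition seminorm_le (j k : nat) (f : R -> C) (r : R) : Prop :=
  forall x, Rabs x ^ j * Cmod (Cderive_n f k x) <= r.

Definition is_schwartz (f : R -> C) : Prop :=
  (forall n x, ex_Cderive_n f n x) /\
  (forall j k, exists M, seminorm_le j k f M).

Record schwartz : Type := mk_schwartz {
  schwartz_fun :> R -> C;
  schwartz_prop : is_schwartz schwartz_fun
}.

Definition smooth (u : R -> R) : Prop := forall n x, ex_derive_n u n x.

Definition rapid (u : R -> R) : Prop :=
  forall j k, exists M, forall x, Rabs x ^ j * Rabs (Derive_n u k x) <= M.

Definition bounded_derivs (m : R -> R) : Prop :=
  forall k, exists M, forall x, Rabs (Derive_n m k x) <= M.

Lemma smooth_ex_derive u : smooth u -> forall x, ex_derive u x.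
Proof. intros H x; exact (H 1%nat x). Qed.

Lemma Derive_n_Derive u n x : Derive_n (Derive u) n x = Derive_n u (S n) x.
Proof.
  change (Derive u) with (Derive_n u 1).
  rewrite Derive_n_comp; f_equal; lia.
Qed.

Lemma smooth_Derive u : smooth u -> smooth (Derive u).
Proof.
  intros H [|n] x; [exact I|].
  apply (ex_derive_ext (Derive_n u (S n))).
  - intros t; symmetry; apply Derive_n_Derive.
  - exact (H (S (S n)) x).
Qed.

Lemma smooth_locally u : smooth u -> forall n x,
  locally x (fun y => forall k, (k <= n)%nat -> ex_derive_n u k y).
Proof. intros H n x; apply filter_forall; intros y k _; apply H. Qed.

Lemma smooth_plus u v : smooth u -> smooth v -> smooth (fun x => u x + v x).
Proof.
  intros Hu Hv n x; apply ex_derive_n_plus; apply smooth_locally; assumption.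
Qed.

Lemma smooth_minus u v : smooth u -> smooth v -> smooth (fun x => u x - v x).
Proof.
  intros Hu Hv n x; apply ex_derive_n_minus; apply smooth_locally; assumption.
Qed.

Lemma smooth_mult u v : smooth u -> smooth v -> smooth (fun x => u x * v x).
Proof.
  intros Hu Hv n.
  assert (H : forall n u v, smooth u -> smooth v -> forall k x, (k <= n)%nat ->
                ex_derive_n (fun x => u x * v x) k x).
  { clear. intros n; induction n as [|n IH]; intros u v Hu Hv k x Hk.
    - replace k with 0%nat by lia; exact I.
    - destruct k as [|[|k]]; [exact I| |].
      + apply (ex_derive_mult u v); apply smooth_ex_derive; assumption.
      + change (ex_derive (Derive_n (fun x => u x * v x) (S k)) x).
        apply (ex_derive_ext
                 (Derive_n (fun y => Derive u y * v y + u y * Derive v y) k)).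
        * intros t; rewrite <- Derive_n_Derive; apply Derive_n_ext; intros y.
          symmetry; apply Derive_mult; apply smooth_ex_derive; assumption.
        * apply (ex_derive_n_plus (fun y => Derive u y * v y)
                   (fun y => u y * Derive v y) (S k));
            apply filter_forall; intros y i Hi; apply IH;
            auto using smooth_Derive; lia. }
  intros x; apply (H n u v Hu Hv n x); lia.
Qed.

Lemma rapid_plus u v : smooth u -> smooth v -> rapid u -> rapid v ->
  rapid (fun x => u x + v x).
Proof.
  intros Su Sv Hu Hv j k.
  destruct (Hu j k) as [M HM]; destruct (Hv j k) as [N HN].
  exists (M + N); intros x.
  rewrite Derive_n_plus by (apply smooth_locally; assumption).
  specialize (HM x); specialize (HN x).
  assert (P : 0 <= Rabs x ^ j) by (apply pow_le, Rabs_pos).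
  pose proof (Rmult_le_compat_l _ _ _ P
    (Rabs_triang (Derive_n u k x) (Derive_n v k x))) as T.
  rewrite Rmult_plus_distr_l in T; lra.
Qed.

Lemma rapid_minus u v : smooth u -> smooth v -> rapid u -> rapid v ->
  rapid (fun x => u x - v x).
Proof.
  intros Su Sv Hu Hv j k.
  destruct (Hu j k) as [M HM]; destruct (Hv j k) as [N HN].
  exists (M + N); intros x.
  rewrite Derive_n_minus by (apply smooth_locally; assumption).
  specialize (HM x); specialize (HN x).
  assert (P : 0 <= Rabs x ^ j) by (apply pow_le, Rabs_pos).
  pose proof (Rmult_le_compat_l _ _ _ P
    (Rabs_triang (Derive_n u k x) (- Derive_n v k x))) as T.
  rewrite Rabs_Ropp, Rmult_plus_distr_l in T; unfold Rminus; lra.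
Qed.

Lemma rapid_Derive u : rapid u -> rapid (Derive u).
Proof.
  intros H j k; destruct (H j (S k)) as [M HM]; exists M; intros x.
  rewrite Derive_n_Derive; apply HM.
Qed.

Lemma bounded_derivs_Derive u : bounded_derivs u -> bounded_derivs (Derive u).
Proof.
  intros H k; destruct (H (S k)) as [M HM]; exists M; intros x.
  rewrite Derive_n_Derive; apply HM.
Qed.

Lemma rapid_mult m u : smooth m -> smooth u -> bounded_derivs m -> rapid u ->
  rapid (fun x => m x * u x).
Proof.
  intros Sm Su Hm Hu j k; revert m u Sm Su Hm Hu.
  induction k as [|k IH]; intros m u Sm Su Hm Hu.
  - destruct (Hm 0%nat) as [N HN]; destruct (Hu j 0%nat) as [M HM].
    exists (N * M); intros x; specialize (HN x); specialize (HM x); simpl in *.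
    rewrite Rabs_mult.
    replace (Rabs x ^ j * (Rabs (m x) * Rabs (u x)))
      with (Rabs (m x) * (Rabs x ^ j * Rabs (u x))) by ring.
    apply Rmult_le_compat; auto using Rabs_pos.
    apply Rmult_le_pos; [apply pow_le|]; apply Rabs_pos.
  - destruct (IH (Derive m) u) as [M HM];
      auto using smooth_Derive, bounded_derivs_Derive.
    destruct (IH m (Derive u)) as [N HN]; auto using smooth_Derive, rapid_Derive.
    exists (M + N); intros x; specialize (HM x); specialize (HN x).
    rewrite <- Derive_n_Derive.
    rewrite (Derive_n_ext _ (fun y => Derive m y * u y + m y * Derive u y))
      by (intros y; apply Derive_mult; apply smooth_ex_derive; assumption).
    rewrite Derive_n_plus by
      (apply smooth_locally, smooth_mult; auto using smooth_Derive).
    assert (P : 0 <= Rabs x ^ j) by (apply pow_le, Rabs_pos).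
    pose proof (Rmult_le_compat_l _ _ _ P
      (Rabs_triang (Derive_n (fun y => Derive m y * u y) k x)
                   (Derive_n (fun y => m y * Derive u y) k x))) as T.
    rewrite Rmult_plus_distr_l in T; lra.
Qed.

Lemma Derive_n_trig t n : forall a b, exists a' b', forall x,
  Derive_n (fun y => a * cos (t * y) + b * sin (t * y)) n x
  = a' * cos (t * x) + b' * sin (t * x).
Proof.
  induction n as [|n IH]; intros a b.
  - exists a, b; reflexivity.
  - destruct (IH (b * t) (- (a * t))) as [a' [b' H]].
    exists a', b'; intros x; rewrite <- H, <- Derive_n_Derive.
    apply Derive_n_ext; intros y; apply is_derive_unique.
    auto_derive; [exact I | ring].
Qed.

Lemma smooth_trig t a b : smooth (fun y => a * cos (t * y) + b * sin (t * y)).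
Proof.
  intros [|n] x; [exact I|].
  destruct (Derive_n_trig t n a b) as [a' [b' H]].
  apply (ex_derive_ext (fun y => a' * cos (t * y) + b' * sin (t * y))).
  - intros y; symmetry; apply H.
  - auto_derive; exact I.
Qed.

Lemma bounded_derivs_trig t a b :
  bounded_derivs (fun y => a * cos (t * y) + b * sin (t * y)).
Proof.
  intros k; destruct (Derive_n_trig t k a b) as [a' [b' H]].
  exists (Rabs a' + Rabs b'); intros x; rewrite H.
  apply Rle_trans with (1 := Rabs_triang _ _); rewrite !Rabs_mult.
  assert (Rabs (cos (t * x)) <= 1) by (apply Rabs_le, COS_bound).
  assert (Rabs (sin (t * x)) <= 1) by (apply Rabs_le, SIN_bound).
  pose proof (Rabs_pos a'); pose proof (Rabs_pos b'); nra.
Qed.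

Lemma is_schwartz_iff f : is_schwartz f <->
  (smooth (fun x => Re (f x)) /\ rapid (fun x => Re (f x))) /\
  (smooth (fun x => Im (f x)) /\ rapid (fun x => Im (f x))).
Proof.
  split.
  - intros [S B].
    repeat split; try (intros n x; apply (S n x));
      intros j k; destruct (B j k) as [M HM]; exists M; intros x;
      apply Rle_trans with (2 := HM x); apply Rmult_le_compat_l;
      try (apply pow_le, Rabs_pos);
      apply Rle_trans with (2 := Rmax_Cmod _); [apply Rmax_l | apply Rmax_r].
  - intros [[S1 B1] [S2 B2]]; split.
    + intros n x; split; auto.
    + intros j k; destruct (B1 j k) as [M HM]; destruct (B2 j k) as [N HN].
      exists (M + N); intros x; specialize (HM x); specialize (HN x).
      assert (P : 0 <= Rabs x ^ j) by (apply pow_le, Rabs_pos).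
      apply Rle_trans with (2 := Rplus_le_compat _ _ _ _ HM HN).
      rewrite <- Rmult_plus_distr_l; apply Rmult_le_compat_l; [exact P|].
      apply Rsqr_incr_0_var;
        [|apply Rplus_le_le_0_compat; apply Rabs_pos].
      unfold Cmod; rewrite Rsqr_sqrt by (apply Rplus_le_le_0_compat; apply pow2_ge_0).
      unfold Cderive_n, Rsqr; simpl.
      set (p := Derive_n _ _ _); set (q := Derive_n _ _ _).
      pose proof (Rabs_pos p); pose proof (Rabs_pos q).
      pose proof (Rsqr_abs p) as Ep; pose proof (Rsqr_abs q) as Eq.
      unfold Rsqr in Ep, Eq; nra.
Qed.

Lemma is_schwartz_plus f g : is_schwartz f -> is_schwartz g ->
  is_schwartz (fun x => f x + g x)%C.
Proof.
  rewrite !is_schwartz_iff; simpl.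
  intros [[? ?] [? ?]] [[? ?] [? ?]];
    repeat split; auto using smooth_plus, rapid_plus.
Qed.

Lemma is_schwartz_mult (m : R -> C) f :
  smooth (fun x => Re (m x)) -> bounded_derivs (fun x => Re (m x)) ->
  smooth (fun x => Im (m x)) -> bounded_derivs (fun x => Im (m x)) ->
  is_schwartz f -> is_schwartz (fun x => m x * f x)%C.
Proof.
  intros S1 B1 S2 B2; rewrite !is_schwartz_iff; simpl.
  intros [[? ?] [? ?]]; split; split.
  - apply smooth_minus; apply smooth_mult; assumption.
  - apply rapid_minus; (apply smooth_mult || apply rapid_mult); assumption.
  - apply smooth_plus; apply smooth_mult; assumption.
  - apply rapid_plus; (apply smooth_mult || apply rapid_mult); assumption.
Qed.

Lemma smooth_bounded_ext u v : (forall x, u x = v x) ->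
  smooth u /\ bounded_derivs u -> smooth v /\ bounded_derivs v.
Proof.
  intros E [S B]; split.
  - intros n x; apply (ex_derive_n_ext u); auto.
  - intros k; destruct (B k) as [M HM]; exists M; intros x.
    rewrite <- (Derive_n_ext u v k x E); auto.
Qed.

Lemma is_schwartz_scal (a : C) f : is_schwartz f ->
  is_schwartz (fun x => a * f x)%C.
Proof.
  assert (H : forall c : R, smooth (fun _ => c) /\ bounded_derivs (fun _ => c)).
  { intros c.
    apply (smooth_bounded_ext (fun y => c * cos (0 * y) + 0 * sin (0 * y))).
    - intros x; rewrite Rmult_0_l, cos_0; ring.
    - split; [apply smooth_trig | apply bounded_derivs_trig]. }
  apply (is_schwartz_mult (fun _ => a)); apply H.
Qed.

Lemma is_schwartz_modul (t : R) f : is_schwartz f ->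
  is_schwartz (fun x => Cexp (Ci * t * x) * f x)%C.
Proof.
  assert (Hc : smooth (fun x => Re (Cexp (Ci * t * x))) /\
               bounded_derivs (fun x => Re (Cexp (Ci * t * x)))).
  { apply (smooth_bounded_ext (fun y => 1 * cos (t * y) + 0 * sin (t * y))).
    - intros x; simpl.
      replace ((0 * t - 1 * 0) * x - (0 * 0 + 1 * t) * 0) with 0 by ring.
      replace ((0 * t - 1 * 0) * 0 + (0 * 0 + 1 * t) * x) with (t * x) by ring.
      rewrite exp_0; ring.
    - split; [apply smooth_trig | apply bounded_derivs_trig]. }
  assert (Hs : smooth (fun x => Im (Cexp (Ci * t * x))) /\
               bounded_derivs (fun x => Im (Cexp (Ci * t * x)))).
  { apply (smooth_bounded_ext (fun y => 0 * cos (t * y) + 1 * sin (t * y))).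
    - intros x; simpl.
      replace ((0 * t - 1 * 0) * x - (0 * 0 + 1 * t) * 0) with 0 by ring.
      replace ((0 * t - 1 * 0) * 0 + (0 * 0 + 1 * t) * x) with (t * x) by ring.
      rewrite exp_0; ring.
    - split; [apply smooth_trig | apply bounded_derivs_trig]. }
  apply (is_schwartz_mult (fun x => Cexp (Ci * t * x)%C)); apply Hc || apply Hs.
Qed.

Definition schwartz_plus (f g : schwartz) : schwartz :=
  mk_schwartz _ (is_schwartz_plus f g (schwartz_prop f) (schwartz_prop g)).

Definition schwartz_scal (a : C) (f : schwartz) : schwartz :=
  mk_schwartz _ (is_schwartz_scal a f (schwartz_prop f)).

Definition schwartz_modul (t : R) (f : schwartz) : schwartz :=
  mk_schwartz _ (is_schwartz_modul t f (schwartz_prop f)).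

(** Neighbourhood filter of [f] in the usual Fréchet topology, the one given
    by the seminorms sup_x |x^j f^(k)(x)|. *)
Definition schwartz_locally (f : schwartz) (P : schwartz -> Prop) : Prop :=
  exists (N : nat) (delta : posreal), forall g : schwartz,
    (forall j k, (j <= N)%nat -> (k <= N)%nat ->
       seminorm_le j k (fun x => g x - f x)%C delta) ->
    P g.

Record tempered : Type := mk_tempered {
  tempered_fun :> schwartz -> C;
  tempered_plus : forall f g : schwartz,
    tempered_fun (schwartz_plus f g) = (tempered_fun f + tempered_fun g)%C;
  tempered_scal : forall (a : C) (f : schwartz),
    tempered_fun (schwartz_scal a f) = (a * tempered_fun f)%C;
  tempered_continuous : forall f : schwartz,
    filterlim tempered_fun (schwartz_locally f) (locally (tempered_fun f))
}.

(** [m] is the value of [T] at [x^n phi(x)], which has to be a test function. *)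
Definition is_weak_moment (T : tempered) (phi : schwartz) (n : nat) (m : C) :
  Prop :=
  exists psi : schwartz,
    (forall x : R, psi x = (RtoC x ^ n * phi x)%C) /\ m = T psi.

Definition weak_cf (T : tempered) (phi : schwartz) (t : R) : C :=
  T (schwartz_modul t phi).

(** [K] is, near 0, a continuous branch of the logarithm of the weak
    characteristic function. *)
Definition is_weak_cgf (T : tempered) (phi : schwartz) (K : R -> C) : Prop :=
  locally 0 (fun t : R =>
    weak_cf T phi t <> RtoC 0 /\ continuous K t /\
    Cexp (K t) = weak_cf T phi t).

(** Near 0 the branches differ by constants in 2 pi i Z, which have no
    influence when [1 <= n]; the cumulant is required not to depend on the
    branch. *)
Definition is_weak_cumulant (T : tempered) (phi : schwartz) (n : nat)
  (kappa : C) : Prop :=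
  (exists K, is_weak_cgf T phi K) /\
  (forall K, is_weak_cgf T phi K ->
     Cdifferentiable_n K n 0 /\ kappa = (/ (Ci ^ n) * Cderive_n K n 0)%C).

(* Main.v *)
(** Continuity of [T] bounds it by finitely many Schwartz seminorms, and each
    seminorm of [(exp (i h x) - 1 - i h x) exp (i t x) phi x] is [O(h ^ 2)];
    hence the weak characteristic function of [phi] is differentiable with
    derivative [i] times that of [x phi].  By iteration it is smooth.  Any
    continuous logarithm [K] of it then satisfies [K' = F' / F] where [F] does
    not vanish, so [K] is smooth and its derivatives do not depend on the
    branch. *)
Require Import Defs.
From Stdlib Require Import Reals.
From Coquelicot Require Import Coquelicot.
From Stdlib Require Import Lra Lia.
Open Scope R_scope.

(** * Mean value estimate and uniform bounds for products with rapidly decreasing functions *)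

(** The derivative is bounded only for [Rabs y <= Rabs x], so that [B] may depend on [x], as it does
    when the estimate is applied a second time to reach a quadratic bound. *)
Lemma Rabs_le_of_derive (f f' : R -> R) (B x : R) :
  (forall y, is_derive f y (f' y)) -> f 0 = 0 ->
  (forall y, Rabs y <= Rabs x -> Rabs (f' y) <= B) ->
  Rabs (f x) <= B * Rabs x.
Proof.
  intros Hd H0 HB.
  destruct (MVT_gen f 0 x f') as [c [Hc E]].
  - intros; apply Hd.
  - intros y _; apply continuity_pt_filterlim, (ex_derive_continuous f).
    exists (f' y); apply Hd.
  - rewrite H0, !Rminus_0_r in E; rewrite E, Rabs_mult.
    apply Rmult_le_compat_r; [apply Rabs_pos|]; apply HB.
    revert Hc; unfold Rmin, Rmax, Rabs.
    destruct (Rle_dec 0 x), (Rcase_abs c), (Rcase_abs x); lra.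
Qed.

(** The growth [1 + x ^ 2] is absorbed by the decay of [u] at the powers [j] and [j + 2]; higher
    derivatives follow from the product rule, whose two terms are again of this form. The weight
    [w], later [h ^ 2], is kept apart so that [M] does not depend on [i]. *)
Lemma rapid_mult_family {I : Type} (P : I -> Prop) (w : I -> R)
  (m : I -> R -> R) (u : R -> R) :
  (forall i, smooth (m i)) -> smooth u -> rapid u ->
  (forall k, exists C, forall i x, P i ->
     Rabs (Derive_n (m i) k x) <= C * w i * (1 + x ^ 2)) ->
  forall j k, exists M, forall i x, P i ->
    Rabs x ^ j * Rabs (Derive_n (fun y => m i y * u y) k x) <= M * w i.
Proof.
  intros Sm Su Ru Bm j k; revert m u Sm Su Ru Bm.
  induction k as [|k IH]; intros m u Sm Su Ru Bm.
  - destruct (Bm 0%nat) as [C HC].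
    destruct (Ru j 0%nat) as [M HM]; destruct (Ru (j + 2)%nat 0%nat) as [N HN].
    exists (C * (M + N)); intros i x Hi.
    specialize (HC i x Hi); specialize (HM x); specialize (HN x); simpl Derive_n in *.
    rewrite pow_add, pow2_abs in HN; rewrite Rabs_mult.
    pose proof (Rabs_pos (m i x)) as Pm; pose proof (pow2_ge_0 x) as Px.
    (* No sign is assumed for [C] or [w i]; that of their product is read off the bound on
       [Rabs (m i x)]. *)
    assert (0 <= C * w i) by nra.
    assert (P0 : 0 <= Rabs x ^ j * Rabs (u x))
      by (apply Rmult_le_pos; [apply pow_le|]; apply Rabs_pos).
    apply Rle_trans with (C * w i * (1 + x ^ 2) * (Rabs x ^ j * Rabs (u x))).
    + replace (Rabs x ^ j * (Rabs (m i x) * Rabs (u x)))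
        with (Rabs (m i x) * (Rabs x ^ j * Rabs (u x))) by ring.
      now apply Rmult_le_compat_r.
    + replace (C * (M + N) * w i) with (C * w i * (M + N)) by ring.
      rewrite Rmult_assoc; apply Rmult_le_compat_l; [assumption|]; lra.
  - destruct (IH (fun i => Derive (m i)) u) as [M HM];
      auto using smooth_Derive.
    { intros l; destruct (Bm (S l)) as [C HC]; exists C; intros i x Hi.
      rewrite Derive_n_Derive; auto. }
    destruct (IH m (Derive u)) as [N HN]; auto using smooth_Derive, rapid_Derive.
    exists (M + N); intros i x Hi; specialize (HM i x Hi); specialize (HN i x Hi).
    rewrite <- Derive_n_Derive.
    rewrite (Derive_n_ext _ (fun y => Derive (m i) y * u y + m i y * Derive u y))
      by (intros y; apply Derive_mult; apply smooth_ex_derive; auto).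
    rewrite Derive_n_plus by
      (apply smooth_locally, smooth_mult; auto using smooth_Derive).
    assert (P0 : 0 <= Rabs x ^ j) by (apply pow_le, Rabs_pos).
    pose proof (Rmult_le_compat_l _ _ _ P0
      (Rabs_triang (Derive_n (fun y => Derive (m i) y * u y) k x)
                   (Derive_n (fun y => m i y * Derive u y) k x))) as T.
    rewrite Rmult_plus_distr_l in T; lra.
Qed.

(** * The second-order remainder of exp (i h x) *)

Lemma Rabs_trig_le (a b y : R) : Rabs (a * cos y + b * sin y) <= Rabs a + Rabs b.
Proof.
  apply Rle_trans with (1 := Rabs_triang _ _); rewrite !Rabs_mult.
  assert (Rabs (cos y) <= 1) by (apply Rabs_le, COS_bound).
  assert (Rabs (sin y) <= 1) by (apply Rabs_le, SIN_bound).
  pose proof (Rabs_pos a); pose proof (Rabs_pos b); nra.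
Qed.

(** Differentiation swaps the coefficients up to sign and multiplies them by [h], so the sum of
    their absolute values does not grow while [Rabs h <= 1]. *)
Lemma Rabs_Derive_n_trig_le (h : R) (n : nat) (a b x : R) : Rabs h <= 1 ->
  Rabs (Derive_n (fun y => a * cos (h * y) + b * sin (h * y)) n x)
    <= Rabs a + Rabs b.
Proof.
  intros Hh; revert a b; induction n as [|n IH]; intros a b.
  - apply Rabs_trig_le.
  - rewrite <- Derive_n_Derive.
    rewrite (Derive_n_ext _ (fun y => b * h * cos (h * y) + - (a * h) * sin (h * y)))
      by (intros y; apply is_derive_unique; auto_derive; [exact I | ring]).
    apply Rle_trans with (1 := IH _ _); rewrite Rabs_Ropp, !Rabs_mult.
    pose proof (Rabs_pos a); pose proof (Rabs_pos b); nra.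
Qed.

(* [a = 1, b = 0] and [a = 0, b = 1] are the real and imaginary parts of
   [exp (i h x) - 1 - i h x]. *)
Definition exp_remainder (a b h x : R) : R :=
  a * (cos (h * x) - 1) + b * (sin (h * x) - h * x).

Lemma is_derive_exp_remainder (a b h x : R) :
  is_derive (exp_remainder a b h) x
    (h * (b * (cos (h * x) - 1) - a * sin (h * x))).
Proof. unfold exp_remainder; auto_derive; [exact I | ring]. Qed.

(** Two derivatives kill the affine part and bring out [h ^ 2], so from order 2 on the trigonometric
    bounds apply. *)
Lemma Derive_n_exp_remainder (a b h : R) (k : nat) (x : R) :
  Derive_n (exp_remainder a b h) (S (S k)) x
  = Derive_n (fun y => - (h ^ 2 * a) * cos (h * y) + - (h ^ 2 * b) * sin (h * y)) k x.
Proof.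
  rewrite <- !Derive_n_Derive; apply Derive_n_ext; intros y.
  rewrite (Derive_ext _ _ _ (fun z => is_derive_unique _ _ _
    (is_derive_exp_remainder a b h z))).
  apply is_derive_unique; auto_derive; [exact I | ring].
Qed.

Lemma smooth_exp_remainder (a b h : R) : smooth (exp_remainder a b h).
Proof.
  intros [|[|[|k]]] x; [exact I | | |].
  - exists (h * (b * (cos (h * x) - 1) - a * sin (h * x))).
    apply is_derive_exp_remainder.
  - apply (ex_derive_ext (fun x => h * (b * (cos (h * x) - 1) - a * sin (h * x)))).
    + intros y; symmetry; apply is_derive_unique, is_derive_exp_remainder.
    + auto_derive; exact I.
  - apply (ex_derive_ext (Derive_n (fun y => - (h ^ 2 * a) * cos (h * y)
      + - (h ^ 2 * b) * sin (h * y)) k)).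
    + intros y; symmetry; apply Derive_n_exp_remainder.
    + exact (smooth_trig h _ _ (S k) x).
Qed.

(** From order 2 on the factor [h ^ 2] is explicit. Orders 1 and 0 follow by the mean value
    estimate, used once and twice from 0, where the remainder and its derivative vanish; this costs
    [Rabs x] and [x ^ 2], both at most [1 + x ^ 2]. *)
Lemma exp_remainder_bound (a b : R) (k : nat) :
  exists C, forall h x, Rabs h <= 1 ->
    Rabs (Derive_n (exp_remainder a b h) k x) <= C * h ^ 2 * (1 + x ^ 2).
Proof.
  exists (Rabs a + Rabs b); intros h x Hh.
  set (A := Rabs a + Rabs b).
  assert (HA : 0 <= A)
    by (unfold A; pose proof (Rabs_pos a); pose proof (Rabs_pos b); lra).
  pose proof (pow2_ge_0 h) as Ph; pose proof (pow2_ge_0 x) as Px.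
  assert (PA : 0 <= A * h ^ 2) by nra.
  assert (E : Rabs (- (h ^ 2 * a)) + Rabs (- (h ^ 2 * b)) = A * h ^ 2).
  { unfold A; rewrite !Rabs_Ropp, !Rabs_mult, (Rabs_pos_eq _ Ph); ring. }
  assert (D1 : forall y, Rabs (h * (b * (cos (h * y) - 1) - a * sin (h * y)))
                 <= A * h ^ 2 * Rabs y).
  { intros y; apply (Rabs_le_of_derive
      (fun y => h * (b * (cos (h * y) - 1) - a * sin (h * y)))
      (fun y => - (h ^ 2 * a) * cos (h * y) + - (h ^ 2 * b) * sin (h * y))).
    - intros z; auto_derive; [exact I | ring].
    - rewrite Rmult_0_r, cos_0, sin_0; ring.
    - intros z _; rewrite <- E; apply Rabs_trig_le. }
  destruct k as [|[|k]].
  - simpl Derive_n.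
    apply Rle_trans with (A * h ^ 2 * Rabs x * Rabs x).
    + apply (Rabs_le_of_derive _ _ _ _ (is_derive_exp_remainder a b h)).
      * unfold exp_remainder; rewrite Rmult_0_r, cos_0, sin_0; ring.
      * intros y Hy; apply Rle_trans with (1 := D1 y).
        now apply Rmult_le_compat_l.
    + rewrite Rmult_assoc; apply Rmult_le_compat_l; [exact PA|].
      rewrite <- (pow2_abs x) ; nra.
  - change (Derive_n (exp_remainder a b h) 1 x) with (Derive (exp_remainder a b h) x).
    rewrite (is_derive_unique _ _ _ (is_derive_exp_remainder a b h x)).
    apply Rle_trans with (1 := D1 x); apply Rmult_le_compat_l; [exact PA|].
    rewrite <- (pow2_abs x); pose proof (pow2_ge_0 (Rabs x - 1)).
    pose proof (Rabs_pos x); nra.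
  - rewrite Derive_n_exp_remainder.
    apply Rle_trans with (1 := Rabs_Derive_n_trig_le h k _ _ x Hh).
    rewrite E; nra.
Qed.

(** * Seminorm bounds for tempered distributions *)

Lemma Cmod_le_abs (z : C) : Cmod z <= Rabs (Re z) + Rabs (Im z).
Proof.
  destruct z as [x y]; simpl.
  replace (x, y) with (RtoC x + Ci * RtoC y)%C
    by (unfold Ci, RtoC, Cplus, Cmult; simpl; f_equal; ring).
  apply Rle_trans with (1 := Cmod_triangle _ _).
  rewrite Cmod_mult, !Cmod_R.
  replace (Cmod Ci) with 1; [lra|].
  symmetry; transitivity (sqrt 1); [|apply sqrt_1].
  unfold Cmod, Ci; simpl; f_equal; ring.
Qed.

(** Continuity at the zero function keeps [T] within 1 on a seminorm ball of radius [delta];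
    homogeneity, with the scale [delta / r], carries this to every [g]. *)
Lemma tempered_bound (T : tempered) (phi : schwartz) :
  exists (N : nat) (C : R), forall (g : schwartz) (r : R), 0 < r ->
    (forall j k, (j <= N)%nat -> (k <= N)%nat -> seminorm_le j k g r) ->
    Cmod (T g) <= C * r.
Proof.
  set (z := schwartz_scal (RtoC 0) phi).
  assert (Tz : T z = RtoC 0).
  { unfold z; rewrite tempered_scal; apply injective_projections; simpl; ring. }
  destruct (tempered_continuous T z (ball (T z) (mkposreal 1 Rlt_0_1))
    (locally_ball _ _)) as [N [delta HN]].
  (* The 2 arises because [ball] in C is componentwise: real and imaginary part are each below 1. *)
  exists N, (2 / delta); intros g r Hr Hg.
  pose proof (cond_pos delta) as Hdelta.
  assert (Hc : 0 < delta / r) by (apply Rdiv_lt_0_compat; assumption).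
  destruct (HN (schwartz_scal (RtoC (delta / r)) g)) as [B1 B2].
  - intros j k Hj Hk x; specialize (Hg j k Hj Hk x).
    replace (Cderive_n _ k x) with (RtoC (delta / r) * Cderive_n g k x)%C.
    + rewrite Cmod_mult, Cmod_R, (Rabs_pos_eq _ (Rlt_le _ _ Hc)).
      apply Rle_trans with (delta / r * r); [|right; field; lra].
      replace (Rabs x ^ j * (delta / r * Cmod (Cderive_n g k x)))
        with (delta / r * (Rabs x ^ j * Cmod (Cderive_n g k x))) by ring.
      apply Rmult_le_compat_l; [lra | exact Hg].
    + unfold Cderive_n; apply injective_projections; simpl.
      * rewrite Rmult_0_l, Rminus_0_r, <- Derive_n_scal_l.
        apply Derive_n_ext; intros y; unfold Re; ring.
      * rewrite Rmult_0_l, Rplus_0_r, <- Derive_n_scal_l.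
        apply Derive_n_ext; intros y; unfold Im; ring.
  - rewrite Tz, tempered_scal in B1, B2.
    unfold ball in B1, B2; simpl in B1, B2.
    unfold AbsRing_ball, abs, minus, plus, opp in B1, B2; simpl in B1, B2.
    rewrite Ropp_0, Rplus_0_r, Rmult_0_l in B1, B2.
    rewrite Rminus_0_r, Rabs_mult, (Rabs_pos_eq (_ / _)) in B1 by lra.
    rewrite Rplus_0_r, Rabs_mult, (Rabs_pos_eq (_ / _)) in B2 by lra.
    apply Rle_trans with (1 := Cmod_le_abs _).
    apply (Rmult_le_reg_l (delta / r)); [exact Hc|].
    replace (delta / r * (2 / delta * r)) with 2 by (field; lra).
    unfold Re, Im; lra.
Qed.

(** Lets the finitely many seminorms that control [T] share one constant, the maximum of theirs. *)
Lemma uniform_upto (P : nat -> R -> Prop) (N : nat) :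
  (forall n M M', M <= M' -> P n M -> P n M') ->
  (forall n, exists M, P n M) ->
  exists M, forall n, (n <= N)%nat -> P n M.
Proof.
  intros Pm Pe; induction N as [|N [M HM]].
  - destruct (Pe 0%nat) as [M HM]; exists M; intros n Hn.
    replace n with 0%nat by lia; exact HM.
  - destruct (Pe (S N)) as [M' HM']; exists (Rmax M M'); intros n Hn.
    destruct (Nat.eq_dec n (S N)) as [->|Hne].
    + apply Pm with (2 := HM'), Rmax_r.
    + apply Pm with M; [apply Rmax_l | apply HM; lia].
Qed.

Lemma uniform_upto2 (P : nat -> nat -> R -> Prop) (N : nat) :
  (forall j k M M', M <= M' -> P j k M -> P j k M') ->
  (forall j k, exists M, P j k M) ->
  exists M, forall j k, (j <= N)%nat -> (k <= N)%nat -> P j k M.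
Proof.
  intros Pm Pe.
  destruct (uniform_upto (fun j M => forall k, (k <= N)%nat -> P j k M) N)
    as [M HM].
  - intros j M M' HM H k Hk; apply Pm with M; auto.
  - intros j; apply uniform_upto; [apply Pm | apply Pe].
  - exists M; auto.
Qed.

(** * Differentiability of the weak characteristic function *)

Lemma Cexp_imaginary (t x : R) :
  Cexp (Ci * RtoC t * RtoC x)%C = (cos (t * x), sin (t * x)).
Proof.
  unfold Cexp; simpl.
  replace ((0 * t - 1 * 0) * x - (0 * 0 + 1 * t) * 0) with 0 by ring.
  replace ((0 * t - 1 * 0) * 0 + (0 * 0 + 1 * t) * x) with (t * x) by ring.
  rewrite exp_0, !Rmult_1_l; reflexivity.
Qed.

(** By linearity the error is [T] applied to the single test function [g h], which factors as the
    exponential remainder times [u]; its seminorms are O(h ^ 2) uniformly in [Rabs h <= 1]. *)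
Lemma weak_cf_expansion (T : tempered) (phi psi : schwartz) (t : R) :
  (forall x : R, psi x = (RtoC x * phi x)%C) ->
  exists M, forall h, Rabs h <= 1 ->
    Cmod (weak_cf T phi (t + h) - weak_cf T phi t
          - RtoC h * (Ci * weak_cf T psi t))%C <= M * h ^ 2.
Proof.
  intros Hpsi.
  set (g h := schwartz_plus (schwartz_modul (t + h) phi)
     (schwartz_plus (schwartz_scal (RtoC (-1)) (schwartz_modul t phi))
        (schwartz_scal (- (RtoC h * Ci))%C (schwartz_modul t psi)))).
  assert (Tg : forall h, T (g h) = (weak_cf T phi (t + h) - weak_cf T phi t
          - RtoC h * (Ci * weak_cf T psi t))%C).
  { intros h; unfold g, weak_cf; rewrite !tempered_plus, !tempered_scal.
    apply injective_projections; simpl; ring. }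
  set (u := schwartz_modul t phi).
  assert (G : forall h x, g h x =
    ((exp_remainder 1 0 h x, exp_remainder 0 1 h x) * u x)%C).
  { intros h x; unfold g, u, exp_remainder; cbn [schwartz_fun schwartz_plus
      schwartz_scal schwartz_modul]; rewrite Hpsi, !Cexp_imaginary.
    replace ((t + h) * x) with (t * x + h * x) by ring.
    rewrite cos_plus, sin_plus.
    destruct (phi x) as [p q]; apply injective_projections; simpl; ring. }
  destruct (proj1 (is_schwartz_iff u) (schwartz_prop u))
    as [[Sre Rre] [Sim Rim]].
  assert (B : forall a b v, smooth v -> rapid v -> forall j k,
    exists M, forall h x, Rabs h <= 1 -> Rabs x ^ j *
      Rabs (Derive_n (fun y => exp_remainder a b h y * v y) k x) <= M * h ^ 2).
  { intros a b v Sv Rv; apply (rapid_mult_family (fun h => Rabs h <= 1)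
      (fun h => h ^ 2)); auto using smooth_exp_remainder, exp_remainder_bound. }
  assert (S : forall j k, exists M, forall h, Rabs h <= 1 ->
            seminorm_le j k (g h) (M * h ^ 2)).
  { intros j k.
    (* The complex product of remainder and [u] splits into four real products, each bounded by
       [B]. *)
    destruct (B 1 0 _ Sre Rre j k) as [M1 H1].
    destruct (B 0 1 _ Sim Rim j k) as [M2 H2].
    destruct (B 1 0 _ Sim Rim j k) as [M3 H3].
    destruct (B 0 1 _ Sre Rre j k) as [M4 H4].
    exists (M1 + M2 + (M3 + M4)); intros h Hh x.
    specialize (H1 h x Hh); specialize (H2 h x Hh);
      specialize (H3 h x Hh); specialize (H4 h x Hh).
    assert (P : 0 <= Rabs x ^ j) by (apply pow_le, Rabs_pos).
    assert (E : Cderive_n (g h) k x =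
      (Derive_n (fun y => exp_remainder 1 0 h y * Re (u y)) k x
       - Derive_n (fun y => exp_remainder 0 1 h y * Im (u y)) k x,
       Derive_n (fun y => exp_remainder 1 0 h y * Im (u y)) k x
       + Derive_n (fun y => exp_remainder 0 1 h y * Re (u y)) k x)).
    { unfold Cderive_n; f_equal.
      - rewrite <- Derive_n_minus by
          (apply smooth_locally, smooth_mult; auto using smooth_exp_remainder).
        apply Derive_n_ext; intros y; rewrite G; reflexivity.
      - rewrite <- Derive_n_plus by
          (apply smooth_locally, smooth_mult; auto using smooth_exp_remainder).
        apply Derive_n_ext; intros y; rewrite G; reflexivity. }
    rewrite E; revert H1 H2 H3 H4.
    set (d1 := Derive_n (fun y => exp_remainder 1 0 h y * Re (u y)) k x).
    set (d2 := Derive_n (fun y => exp_remainder 0 1 h y * Im (u y)) k x).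
    set (d3 := Derive_n (fun y => exp_remainder 1 0 h y * Im (u y)) k x).
    set (d4 := Derive_n (fun y => exp_remainder 0 1 h y * Re (u y)) k x).
    intros H1 H2 H3 H4.
    apply Rle_trans with
      (Rabs x ^ j * (Rabs d1 + Rabs d2 + (Rabs d3 + Rabs d4))); [|lra].
    apply Rmult_le_compat_l; [exact P|].
    apply Rle_trans with (1 := Cmod_le_abs _); simpl.
    pose proof (Rabs_triang d1 (- d2)) as T1; rewrite Rabs_Ropp in T1.
    pose proof (Rabs_triang d3 d4); unfold Rminus; lra. }
  destruct (tempered_bound T phi) as [N [C HC]].
  assert (L : exists M, forall j k, (j <= N)%nat -> (k <= N)%nat ->
            forall h, Rabs h <= 1 -> seminorm_le j k (g h) (M * h ^ 2)).
  { apply (uniform_upto2 (fun j k M => forall h, Rabs h <= 1 ->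
      seminorm_le j k (g h) (M * h ^ 2))); [|exact S].
    intros j k M M' HM Hjk h Hh x; apply Rle_trans with (1 := Hjk h Hh x).
    apply Rmult_le_compat_r; [apply pow2_ge_0 | exact HM]. }
  destruct L as [M HM].
  (* The bound on [T] asks for a positive [r]: [Rmax M 1] makes the constant positive, and [h = 0],
     where the error vanishes, is split off. *)
  exists (C * Rmax M 1); intros h Hh; rewrite <- Tg.
  destruct (Req_dec h 0) as [->|Hh0].
  - rewrite Tg, Rplus_0_r.
    replace (weak_cf T phi t - weak_cf T phi t - 0 * (Ci * weak_cf T psi t))%C
      with (RtoC 0) by (apply injective_projections; simpl; ring).
    rewrite Cmod_0; lra.
  - assert (Ph : 0 < h ^ 2) by (apply pow2_gt_0; assumption).
    rewrite Rmult_assoc; apply HC.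
    + apply Rmult_lt_0_compat; [|exact Ph].
      apply Rlt_le_trans with (2 := Rmax_r M 1), Rlt_0_1.
    + intros j k Hj Hk x; apply Rle_trans with (1 := HM j k Hj Hk h Hh x).
      apply Rmult_le_compat_r; [lra | apply Rmax_l].
Qed.

Lemma is_derive_of_quadratic_error (f : R -> R) (t l M : R) :
  (forall h, Rabs h <= 1 -> Rabs (f (t + h) - f t - h * l) <= M * h ^ 2) ->
  is_derive f t l.
Proof.
  intros H; apply is_derive_Reals; intros eps Heps.
  (* The error of the difference quotient is at most [M * Rabs h]; [Rabs M + 1] is a safe
     denominator whatever the value of [M]. *)
  assert (HM : 0 < Rabs M + 1) by (pose proof (Rabs_pos M); lra).
  assert (Hd : 0 < Rmin 1 (eps / (Rabs M + 1)))
    by (apply Rmin_pos; [lra | apply Rdiv_lt_0_compat; assumption]).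
  exists (mkposreal _ Hd); intros h Hh0 Hh; simpl in Hh.
  apply Rmin_Rgt_l in Hh as [Hh1 Hh2].
  specialize (H h (Rlt_le _ _ Hh1)).
  assert (Ph : 0 < Rabs h) by (apply Rabs_pos_lt; assumption).
  replace ((f (t + h) - f t) / h - l) with ((f (t + h) - f t - h * l) / h)
    by (field; assumption).
  unfold Rdiv; rewrite Rabs_mult, Rabs_inv.
  apply Rmult_lt_reg_r with (1 := Ph).
  rewrite Rmult_assoc, Rinv_l, Rmult_1_r by lra.
  apply Rle_lt_trans with (1 := H); rewrite <- pow2_abs.
  apply (Rmult_lt_compat_r _ _ _ HM) in Hh2.
  unfold Rdiv in Hh2; rewrite Rmult_assoc, Rinv_l, Rmult_1_r in Hh2 by lra.
  pose proof (Rle_abs M); nra.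
Qed.

(** The linear term of the expansion is [i] times the function of [psi], and multiplication by [i]
    swaps the two parts with one change of sign. *)
Lemma is_derive_weak_cf (T : tempered) (phi psi : schwartz) (t : R) :
  (forall x : R, psi x = (RtoC x * phi x)%C) ->
  is_derive (fun s => Re (weak_cf T phi s)) t (- Im (weak_cf T psi t)) /\
  is_derive (fun s => Im (weak_cf T phi s)) t (Re (weak_cf T psi t)).
Proof.
  intros Hpsi; destruct (weak_cf_expansion T phi psi t Hpsi) as [M HM].
  split; apply (is_derive_of_quadratic_error _ _ _ M); intros h Hh;
    apply Rle_trans with (2 := HM h Hh); apply Rle_trans with (2 := Rmax_Cmod _);
    [refine (Rle_trans _ _ _ _ (Rmax_l _ _)) | refine (Rle_trans _ _ _ _ (Rmax_r _ _))];
    apply Req_le; f_equal; unfold Re, Im; simpl; ring.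
Qed.

(** * Differentiability of finite order on a set *)

(** Carrying each derivative as a witness makes closure under products and inverses a plain
    induction, with no formulas for [Derive_n]. *)
Fixpoint differentiable_on (U : R -> Prop) (n : nat) (u : R -> R) : Prop :=
  match n with
  | O => True
  | S n => exists u', (forall x, U x -> is_derive u x (u' x)) /\
                      differentiable_on U n u'
  end.

Lemma differentiable_on_pred (U : R -> Prop) (n : nat) (u : R -> R) :
  differentiable_on U (S n) u -> differentiable_on U n u.
Proof.
  revert u; induction n as [|n IH]; intros u [u' [Hu Hu']]; [exact I|].
  exists u'; auto.
Qed.

Lemma differentiable_on_plus (U : R -> Prop) (n : nat) (u v : R -> R) :
  differentiable_on U n u -> differentiable_on U n v ->
  differentiable_on U n (fun x => u x + v x).
Proof.
  revert u v; induction n as [|n IH]; intros u v; [easy|].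
  intros [u' [Hu Hu']] [v' [Hv Hv']].
  exists (fun x => u' x + v' x); split; [|auto].
  intros x Hx; apply (is_derive_plus u v); auto.
Qed.

Lemma differentiable_on_opp (U : R -> Prop) (n : nat) (u : R -> R) :
  differentiable_on U n u -> differentiable_on U n (fun x => - u x).
Proof.
  revert u; induction n as [|n IH]; intros u; [easy|].
  intros [u' [Hu Hu']]; exists (fun x => - u' x); split; [|auto].
  intros x Hx; apply (is_derive_opp u); auto.
Qed.

Lemma differentiable_on_mult (U : R -> Prop) (n : nat) (u v : R -> R) :
  differentiable_on U n u -> differentiable_on U n v ->
  differentiable_on U n (fun x => u x * v x).
Proof.
  revert u v; induction n as [|n IH]; intros u v Hu Hv; [easy|].
  pose proof (differentiable_on_pred _ _ _ Hu) as Hun.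
  pose proof (differentiable_on_pred _ _ _ Hv) as Hvn.
  destruct Hu as [u' [Hu Hu']], Hv as [v' [Hv Hv']].
  exists (fun x => u' x * v x + u x * v' x); split.
  - intros x Hx; apply (is_derive_mult u v); auto using Rmult_comm.
  - apply differentiable_on_plus; auto.
Qed.

(** The derivative [- u' / u ^ 2] contains [/ u] itself, needed at one order less, which is what the
    induction supplies. *)
Lemma differentiable_on_inv (U : R -> Prop) (n : nat) (u : R -> R) :
  (forall x, U x -> u x <> 0) ->
  differentiable_on U n u -> differentiable_on U n (fun x => / u x).
Proof.
  intros H0; induction n as [|n IH]; intros Hu; [easy|].
  pose proof (IH (differentiable_on_pred _ _ _ Hu)) as Hi.
  destruct Hu as [u' [Hu Hu']].
  exists (fun x => - u' x * (/ u x * / u x)); split.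
  - intros x Hx.
    replace (- u' x * (/ u x * / u x)) with (- u' x / u x ^ 2)
      by (field; auto).
    apply is_derive_inv; auto.
  - repeat apply differentiable_on_mult; auto using differentiable_on_opp.
Qed.

Lemma locally_open (U : R -> Prop) (P : R -> Prop) (x : R) :
  open U -> U x -> (forall y, U y -> P y) -> locally x P.
Proof. intros Ho Hx HP; apply filter_imp with (1 := HP); apply Ho; exact Hx. Qed.

Lemma differentiable_on_ext (U : R -> Prop) (n : nat) (u v : R -> R) :
  open U -> (forall x, U x -> u x = v x) ->
  differentiable_on U n u -> differentiable_on U n v.
Proof.
  intros Ho E; destruct n as [|n]; [easy|].
  intros [u' [Hu Hu']]; exists u'; split; [|exact Hu'].
  intros x Hx; apply (is_derive_ext_loc u); auto.
  apply (locally_open U); auto.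
Qed.

(** By uniqueness of derivatives, [u'] agrees on [U] with the witness hidden in the hypothesis. *)
Lemma differentiable_on_derive (U : R -> Prop) (n : nat) (u u' : R -> R) :
  open U -> (forall x, U x -> is_derive u x (u' x)) ->
  differentiable_on U (S n) u -> differentiable_on U n u'.
Proof.
  intros Ho Hu [v [Hv Sv]]; apply (differentiable_on_ext U n v); auto.
  intros x Hx; rewrite <- (is_derive_unique _ _ _ (Hv x Hx)).
  apply is_derive_unique; auto.
Qed.

Lemma Derive_n_S_on (U : R -> Prop) (u u' : R -> R) (n : nat) (x : R) :
  open U -> (forall y, U y -> is_derive u y (u' y)) -> U x ->
  Derive_n u (S n) x = Derive_n u' n x.
Proof.
  intros Ho Hu Hx; rewrite <- Derive_n_Derive; apply Derive_n_ext_loc.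
  apply (locally_open U); auto; intros y Hy; apply is_derive_unique; auto.
Qed.

(** [Derive_n u (S k)] is known to agree with [Derive_n u' k] only on [U]; openness makes that
    agreement local enough to transfer differentiability. *)
Lemma differentiable_on_ex_derive_n (U : R -> Prop) (n k : nat) (u : R -> R) (x : R) :
  open U -> differentiable_on U n u -> (k <= n)%nat -> U x -> ex_derive_n u k x.
Proof.
  intros Ho; revert u k; induction n as [|n IH]; intros u k Hu Hk Hx.
  - replace k with 0%nat by lia; exact I.
  - destruct Hu as [u' [Hu Hu']]; destruct k as [|[|k]]; [exact I| |].
    + exists (u' x); apply Hu, Hx.
    + apply (ex_derive_ext_loc (Derive_n u' k)).
      * apply (locally_open U); auto; intros y Hy; symmetry.
        apply (Derive_n_S_on U); auto.
      * apply (IH u' (S k)); auto; lia.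
Qed.

(** * Smoothness of the weak characteristic function *)

Lemma weak_cf_differentiable_on (T : tempered) (phi : schwartz) (U : R -> Prop) :
  (forall n : nat, exists m : C, is_weak_moment T phi n m) ->
  forall k, differentiable_on U k (fun t => Re (weak_cf T phi t)) /\
            differentiable_on U k (fun t => Im (weak_cf T phi t)).
Proof.
  intros hmom k.
  (* The claim covers all [x ^ n * phi] at once, since each derivative raises [n] by one; the moment
     hypothesis supplies the next test function. *)
  assert (H : forall n (psi : schwartz), (forall x, psi x = (RtoC x ^ n * phi x)%C) ->
    differentiable_on U k (fun t => Re (weak_cf T psi t)) /\
    differentiable_on U k (fun t => Im (weak_cf T psi t))).
  { induction k as [|k IH]; intros n psi Hpsi; [easy|].
    destruct (hmom (S n)) as [m [chi [Hchi _]]].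
    destruct (IH _ chi Hchi) as [Dre Dim].
    assert (D : forall t, is_derive (fun s => Re (weak_cf T psi s)) t
                            (- Im (weak_cf T chi t)) /\
                          is_derive (fun s => Im (weak_cf T psi s)) t
                            (Re (weak_cf T chi t))).
    { intros t; apply is_derive_weak_cf; intros x; rewrite Hpsi, Hchi; simpl.
      symmetry; apply Cmult_assoc. }
    split.
    - exists (fun t => - Im (weak_cf T chi t)); split.
      + intros t _; apply D.
      + apply differentiable_on_opp, Dim.
    - exists (fun t => Re (weak_cf T chi t)); split; [|exact Dre].
      intros t _; apply D. }
  apply (H 0%nat); intros x; simpl; rewrite Cmult_1_l; reflexivity.
Qed.

(** * Continuous branches of the complex logarithm *)

Lemma Cexp_sqr_mod (z : C) (a b : R) : Cexp z = (a, b) ->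
  a ^ 2 + b ^ 2 = exp (2 * Re z).
Proof.
  unfold Cexp; intros E; injection E as <- <-.
  replace (2 * Re z) with (Re z + Re z) by ring; rewrite exp_plus.
  pose proof (sin2_cos2 (Im z)) as H; unfold Rsqr in H.
  transitivity (exp (Re z) * exp (Re z) *
    (sin (Im z) * sin (Im z) + cos (Im z) * cos (Im z))); [ring | rewrite H; ring].
Qed.

(** With [F = a + i b], the two values are the parts of [F' / F]. [Re K] is half the logarithm of
    |F|^2; near [t], [Im K] is [Im (K t)] plus the argument of [F(s)] times the conjugate of [F(t)],
    an arctangent. *)
Lemma is_derive_log_branch (U : R -> Prop) (a b a' b' : R -> R) (K : R -> C) (t : R) :
  open U -> U t -> is_derive a t (a' t) -> is_derive b t (b' t) ->
  continuous K t -> (forall s, U s -> Cexp (K s) = (a s, b s)) ->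
  is_derive (fun s => Re (K s)) t
    ((a t * a' t + b t * b' t) * / (a t * a t + b t * b t)) /\
  is_derive (fun s => Im (K s)) t
    ((b' t * a t + - (a' t * b t)) * / (a t * a t + b t * b t)).
Proof.
  intros Ho Ht Ha Hb HK HE.
  assert (N : 0 < a t ^ 2 + b t ^ 2)
    by (rewrite (Cexp_sqr_mod _ _ _ (HE t Ht)); apply exp_pos).
  pose proof (is_derive_unique _ _ _ Ha) as Da.
  pose proof (is_derive_unique _ _ _ Hb) as Db.
  assert (Ea : ex_derive a t) by (eexists; apply Ha).
  assert (Eb : ex_derive b t) by (eexists; apply Hb).
  split.
  - apply (is_derive_ext_loc (fun s => / 2 * ln (a s ^ 2 + b s ^ 2))).
    + apply (locally_open U); auto; intros s Hs.
      rewrite (Cexp_sqr_mod _ _ _ (HE s Hs)), ln_exp.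
      change (/ 2 * (2 * Re (K s)) = Re (K s)); field.
    + auto_derive.
      * repeat split; auto; simpl in N; lra.
      * rewrite <- Da, <- Db; simpl in N |- *.
        change (Derive (fun x => a x)) with (Derive a).
        change (Derive (fun x => b x)) with (Derive b).
        field; nra.
  - (* [Im K s - Im K t] stays in the domain where atan inverts tan. *)
    apply (is_derive_ext_loc (fun s => Im (K t) +
      atan ((b s * a t - a s * b t) / (a s * a t + b s * b t)))).
    + assert (HPI : 0 < PI / 2) by (pose proof PI_RGT_0; lra).
      pose proof (proj1 (filterlim_locally _ _) HK (mkposreal _ HPI)) as HB.
      apply filter_imp with (2 := filter_and _ _ (Ho t Ht) HB); intros s [Hs [_ B]].
      change (Rabs (Im (K s) - Im (K t)) < PI / 2) in B.
      apply Rabs_lt_between in B.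
      pose proof (HE s Hs) as E1; pose proof (HE t Ht) as E2.
      unfold Cexp in E1, E2; injection E1 as <- <-; injection E2 as <- <-.
      set (es := exp (Re (K s))); set (et := exp (Re (K t))).
      assert (0 < es) by apply exp_pos; assert (0 < et) by apply exp_pos.
      replace (es * sin (Im (K s)) * (et * cos (Im (K t))) -
               es * cos (Im (K s)) * (et * sin (Im (K t))))
        with (es * et * sin (Im (K s) - Im (K t)))
        by (rewrite sin_minus; ring).
      replace (es * cos (Im (K s)) * (et * cos (Im (K t))) +
               es * sin (Im (K s)) * (et * sin (Im (K t))))
        with (es * et * cos (Im (K s) - Im (K t)))
        by (rewrite cos_minus; ring).
      assert (0 < cos (Im (K s) - Im (K t))) by (apply cos_gt_0; lra).
      replace (es * et * sin (Im (K s) - Im (K t)) /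
               (es * et * cos (Im (K s) - Im (K t))))
        with (tan (Im (K s) - Im (K t))) by (unfold tan; field; lra).
      rewrite atan_tan by lra.
      change (Im (K t) + (Im (K s) - Im (K t)) = Im (K s)); ring.
    + auto_derive.
      * repeat split; auto; simpl in N; lra.
      * rewrite <- Da, <- Db; simpl in N |- *.
        change (Derive (fun x => a x)) with (Derive a).
        change (Derive (fun x => b x)) with (Derive b).
        (* At [s = t] the arctangent is taken at 0, where its derivative is 1. *)
        replace (b t * a t - a t * b t) with 0 by ring.
        field; nra.
Qed.

(** [acos x] lies on the upper half circle, so its sine is [Rabs y]; a negative [y] calls for the
    opposite angle. *)
Lemma exists_angle (x y : R) : x ^ 2 + y ^ 2 = 1 ->
  exists theta, cos theta = x /\ sin theta = y.
Proof.
  intros H.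
  assert (Hx : -1 <= x <= 1) by nra.
  assert (Hs : sin (acos x) = Rabs y).
  { rewrite sin_acos, <- sqrt_Rsqr_abs by assumption; f_equal; unfold Rsqr; lra. }
  destruct (Rle_dec 0 y) as [Hy|Hy].
  - exists (acos x); rewrite Hs, Rabs_pos_eq, cos_acos by assumption; auto.
  - exists (- acos x); rewrite cos_neg, sin_neg, Hs, Rabs_left, cos_acos by lra.
    split; ring.
Qed.

Lemma continuous_pair (f g : R -> R) (t : R) :
  continuous f t -> continuous g t -> continuous (fun s => (f s, g s) : C) t.
Proof.
  intros Hf Hg; apply filterlim_locally; intros eps.
  apply filter_imp with (2 := filter_and _ _
    (proj1 (filterlim_locally _ _) Hf eps) (proj1 (filterlim_locally _ _) Hg eps)).
  intros s [H1 H2]; split; assumption.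
Qed.

(** With [F = a + i b], [theta] an argument of [F(0)] and [p + i q] the product of [F(t)] with the
    conjugate of [F(0)], an argument of [F(t)] is [theta + atan (q / p)] while [p > 0]; this holds
    near 0 because [p 0 = N 0]. *)
Lemma exists_log_branch (a b : R -> R) :
  (forall t, ex_derive a t) -> (forall t, ex_derive b t) ->
  0 < a 0 ^ 2 + b 0 ^ 2 ->
  exists K : R -> C, locally 0 (fun t =>
    0 < a t ^ 2 + b t ^ 2 /\ continuous K t /\ Cexp (K t) = (a t, b t)).
Proof.
  intros Ha Hb H0.
  set (N t := a t ^ 2 + b t ^ 2) in *; change (0 < N 0) in H0.
  set (p t := a t * a 0 + b t * b 0); set (q t := b t * a 0 - a t * b 0).
  destruct (exists_angle (a 0 / sqrt (N 0)) (b 0 / sqrt (N 0))) as [theta [Hc Hs]].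
  { pose proof (sqrt_lt_R0 _ H0) as Hr; pose proof (sqrt_sqrt _ (Rlt_le _ _ H0)) as Sr.
    set (r := sqrt (N 0)) in *; transitivity (N 0 / (r * r)).
    - unfold N; field; lra.
    - rewrite Sr; field; lra. }
  exists (fun t => (/ 2 * ln (N t), theta + atan (q t / p t))).
  assert (Hp : locally 0 (fun t => 0 < p t)).
  { apply (proj1 (continuity_pt_filterlim p 0)).
    - apply continuity_pt_filterlim, (ex_derive_continuous p).
      unfold p; auto_derive; auto.
    - apply (open_gt 0); unfold p; unfold N in H0; nra. }
  apply filter_imp with (2 := Hp); intros t Pt.
  (* Multiplicativity of the squared modulus; with [p t > 0] it forces [N t > 0]. *)
  assert (Q : p t ^ 2 + q t ^ 2 = N t * N 0) by (unfold p, q, N; ring).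
  assert (Nt : 0 < N t).
  { apply Rmult_lt_reg_r with (1 := H0); rewrite <- Q, Rmult_0_l.
    pose proof (pow2_ge_0 (q t)); nra. }
  split; [exact Nt|]; split.
  - apply continuous_pair.
    + apply (ex_derive_continuous (fun t => / 2 * ln (N t))).
      unfold N in *; auto_derive; repeat split; auto; simpl in Nt; lra.
    + apply (ex_derive_continuous (fun t => theta + atan (q t / p t))).
      unfold p, q in *; auto_derive; repeat split; auto; lra.
  - assert (Hr0 : 0 < sqrt (N 0)) by (apply sqrt_lt_R0; exact H0).
    assert (Hrt : 0 < sqrt (N t)) by (apply sqrt_lt_R0; exact Nt).
    assert (S0 : sqrt (N 0) * sqrt (N 0) = N 0) by (apply sqrt_sqrt; lra).
    assert (St : sqrt (N t) * sqrt (N t) = N t) by (apply sqrt_sqrt; lra).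
    assert (Er : exp (/ 2 * ln (N t)) = sqrt (N t)).
    { rewrite <- (exp_ln (sqrt (N t))) by exact Hrt; f_equal.
      rewrite <- St at 1; rewrite ln_mult by assumption; field. }
    (* This root is the denominator in [cos_atan] and [sin_atan]; by [Q], the hypotenuse over the
       legs [p t] and [q t] is [sqrt (N t) * sqrt (N 0)]. *)
    assert (E : sqrt (1 + (q t / p t)²) = sqrt (N t) * sqrt (N 0) / p t).
    { apply sqrt_lem_1.
      - pose proof (Rle_0_sqr (q t / p t)); lra.
      - apply Rlt_le, Rdiv_lt_0_compat; [apply Rmult_lt_0_compat|]; assumption.
      - transitivity (sqrt (N t) * sqrt (N t) * (sqrt (N 0) * sqrt (N 0)) / (p t ^ 2));
          [field; lra|].
        rewrite S0, St, <- Q; unfold Rsqr; field; lra. }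
    unfold Cexp; cbn [Re Im fst snd]; rewrite Er, cos_plus, sin_plus.
    rewrite cos_atan, sin_atan, E, Hc, Hs.
    (* Both parts come from [F(0) * (p t + i q t) = N 0 * F(t)]. *)
    f_equal.
    + transitivity ((a 0 * p t - b 0 * q t) / (sqrt (N 0) * sqrt (N 0)));
        [field; lra|].
      rewrite S0; unfold p, q, N; field; unfold N in H0; lra.
    + transitivity ((b 0 * p t + a 0 * q t) / (sqrt (N 0) * sqrt (N 0)));
        [field; lra|].
      rewrite S0; unfold p, q, N; field; unfold N in H0; lra.
Qed.

(** * Existence and branch independence of the weak cumulants *)

Theorem proposition4p4 (T : tempered) (phi : schwartz)
  (hmom : forall n : nat, exists m : C, is_weak_moment T phi n m)
  (h0 : weak_cf T phi 0 <> RtoC 0) :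
  forall n : nat, (1 <= n)%nat -> exists kappa : C, is_weak_cumulant T phi n kappa.
Proof.
  intros n Hn.
  set (a t := Re (weak_cf T phi t)); set (b t := Im (weak_cf T phi t)).
  assert (Fab : forall t, weak_cf T phi t = (a t, b t))
    by (intros t; apply surjective_pairing).
  assert (Sab : forall U k, differentiable_on U k a /\ differentiable_on U k b)
    by (intros U k; apply weak_cf_differentiable_on; exact hmom).
  assert (Hne : forall t, 0 < a t ^ 2 + b t ^ 2 <-> weak_cf T phi t <> RtoC 0).
  { intros t; rewrite Fab; split.
    - intros H E; injection E as E1 E2; rewrite E1, E2 in H; simpl in H; lra.
    - intros H; destruct (Req_dec (a t) 0) as [Ea|Ea].
      + destruct (Req_dec (b t) 0) as [Eb|Eb].
        * destruct H; rewrite Ea, Eb; reflexivity.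
        * pose proof (pow2_ge_0 (a t)); pose proof (pow2_gt_0 _ Eb); lra.
      + pose proof (pow2_ge_0 (b t)); pose proof (pow2_gt_0 _ Ea); lra. }
  (* The derivatives are fixed on the whole line before any branch is chosen, so that [kappa] cannot
     depend on [K]. *)
  destruct (Sab (fun _ => True) 1%nat) as [[a' [Ha _]] [b' [Hb _]]].
  assert (Da : forall t, is_derive a t (a' t)) by auto.
  assert (Db : forall t, is_derive b t (b' t)) by auto.
  set (lre t := (a t * a' t + b t * b' t) * / (a t * a t + b t * b t)).
  set (lim t := (b' t * a t + - (a' t * b t)) * / (a t * a t + b t * b t)).
  (* [lre] and [lim], the parts of [F' / F], already account for one derivative of [K], hence the
     order [n - 1]. *)
  exists (/ (Ci ^ n) * (Derive_n lre (n - 1) 0, Derive_n lim (n - 1) 0))%C.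
  split.
  - destruct (exists_log_branch a b) as [K HK].
    + intros t; exists (a' t); apply Da.
    + intros t; exists (b' t); apply Db.
    + apply Hne, h0.
    + exists K; apply filter_imp with (2 := HK); intros t [H1 [H2 H3]].
      rewrite <- Fab in H3; repeat split; auto; apply Hne, H1.
  - intros K HK0.
    (* Taking the interior of the set where [K] is a continuous logarithm makes [U] open; it
       contains 0 by [HK0]. *)
    set (U t := locally t (fun s => weak_cf T phi s <> RtoC 0 /\
      continuous K s /\ Cexp (K s) = weak_cf T phi s)).
    assert (Uo : open U) by (intros t; apply locally_locally).
    assert (U0 : U 0) by exact HK0.
    assert (HK : forall t, U t -> weak_cf T phi t <> RtoC 0 /\
      continuous K t /\ Cexp (K t) = weak_cf T phi t)
      by (intros t Ut; exact (locally_singleton _ _ Ut)).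
    assert (DK : forall t, U t -> is_derive (fun s => Re (K s)) t (lre t) /\
                                  is_derive (fun s => Im (K s)) t (lim t)).
    { intros t Ut; apply (is_derive_log_branch U); auto.
      - apply HK, Ut.
      - intros s Us; rewrite <- Fab; apply HK, Us. }
    assert (HN : forall t, U t -> a t * a t + b t * b t <> 0).
    { intros t Ut; destruct (HK t Ut) as [Ht _]; apply Hne in Ht; simpl in Ht; lra. }
    (* [a'] and [b'] were obtained from order 1 alone; their smoothness comes back through
       uniqueness of derivatives. *)
    assert (Sa' : forall k, differentiable_on U k a' /\ differentiable_on U k b').
    { intros k; split;
        [apply (differentiable_on_derive U k a) | apply (differentiable_on_derive U k b)];
        auto; apply Sab. }
    assert (Sl : forall k, differentiable_on U k lre /\ differentiable_on U k lim).
    { intros k; destruct (Sab U k), (Sa' k).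
      split; apply differentiable_on_mult;
        auto 7 using differentiable_on_plus, differentiable_on_mult,
          differentiable_on_opp, differentiable_on_inv. }
    assert (SK : forall k t, U t -> ex_Cderive_n K k t).
    { intros k t Ut; split; apply (differentiable_on_ex_derive_n U (S k)); auto.
      - exists lre; split; [intros s Us; apply DK, Us | apply Sl].
      - exists lim; split; [intros s Us; apply DK, Us | apply Sl]. }
    split; [split|].
    + apply (locally_open U); auto.
    + auto.
    + destruct n as [|n]; [lia|]; f_equal; unfold Cderive_n.
      replace (S n - 1)%nat with n by lia.
      f_equal; symmetry; apply (Derive_n_S_on U); auto; intros s Us; apply DK, Us.
Qed.
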